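(* In an irreducible Markov renewal process on a finite state space $S=\{1,\dots,m\}$, with embedded chain transition matrix $P$ and stationary probability vector $\pi$ of the embedded chain, mean sojourn time vector $\mu$, $\lambda=\pi^T\mu>0$, and mean first passage times $m_{ij}$, the mixture $k_i^{(3)}=\sum_{j=1}^m m_{ij}/m_{jj}$ is independent of the initial state $i$ if and only if the mean sojourn times $\mu_j$ are the same for all states $j$. Under the restriction $\mu=\lambda e$, one has $k_i^{(3)}=K_C^{(3)}$ for all $i$, where $$K_C^{(3)}=1+\mathrm{tr}(G)-\mathrm{tr}(G\Pi)=\mathrm{tr}(Z)=1+\mathrm{tr}(A^{\#})=1+\mathrm{tr}(\widetilde G)-\frac{1}{\lambda u^Te},$$ for any g-inverse $G$ of $I-P$, $Z=[I-P+\Pi]^{-1}$, $A^{\#}$ the group inverse of $I-P$, and $\widetilde G=[I-P+\mu u^T]^{-1}$ for any $u\in\mathbb{R}^m$ with $u^Te\neq0$.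
   Context: A Markov renewal process (MRP) $\{(X_n,T_n),n\ge 0\}$ on $S=\{1,\dots,m\}$ has $T_0=0\le T_1\le T_2\le\cdots$ and semi-Markov kernel $Q_{ij}(t)=P\{X_{n+1}=j,\ T_{n+1}-T_n\le t\mid X_n=i\}$ (Markov property: conditionally on the past up to step $n$, the law of $(X_{n+1},T_{n+1}-T_n)$ depends only on $X_n$, through this kernel). The embedded Markov chain $\{X_n\}$ has transition matrix $P=[p_{ij}]$, $p_{ij}=Q_{ij}(+\infty)$; the MRP is called irreducible when $P$ is irreducible. Put $\mu_{ij}=\int_0^\infty t\,dQ_{ij}(t)$, assumed finite, and $\mu_i=\sum_k\mu_{ik}$, the mean sojourn time on a visit to state $i$; $\mu=(\mu_1,\dots,\mu_m)^T$. $\pi=(\pi_1,\dots,\pi_m)^T$ is the unique vector with $\pi^TP=\pi^T$, $\pi^Te=1$, where $e=(1,\dots,1)^T$; $\Pi=e\pi^T$. $\lambda=\pi^T\mu$, assumed positive. The mean first passage time is $m_{ij}=E[T_{ij}\mid X_0=i]$, where $T_{ij}=T_n$ with $n=\min\{r\ge1: X_r=j\}$ given $X_0=i$ (the return time if $i=j$); these are all finite. A g-inverse (one-condition generalized inverse) of $I-P$ is any matrix $G$ with $(I-P)G(I-P)=I-P$. The group inverse $A^{\#}$ of $A=I-P$ is the unique matrix with $AA^{\#}A=A$, $A^{\#}AA^{\#}=A^{\#}$, $AA^{\#}=A^{\#}A$; it equals $Z-\Pi$. *)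

(* Defs.v *)
From HB Require Import structures.
From mathcomp Require Import all_boot all_order all_algebra.
From mathcomp Require Import all_classical all_reals all_analysis.

Set Implicit Arguments.
Unset Strict Implicit.
Unset Printing Implicit Defensive.

Import Order.TTheory GRing.Theory Num.Theory.
Import numFieldNormedType.Exports.

Local Open Scope classical_set_scope.
Local Open Scope ring_scope.

Section matrices.
Context {R : realType} {m : nat}.
Implicit Types (A G P : 'M[R]_m) (p : 'cV[R]_m).

Definition irreducible_mx P : Prop :=
  forall i j : 'I_m, exists n : nat, 0 < (P ^+ n) i j.

Definition ones : 'cV[R]_m := const_mx 1.

Definition stationary_prob P p : Prop :=
  p^T *m P = p^T /\ p^T *m ones = 1%:M.

Definition is_ginverse A G : Prop := A *m G *m A = A.

Definition is_group_inverse A G : Prop :=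
  [/\ A *m G *m A = A, G *m A *m G = G & A *m G = G *m A].

End matrices.

(* The entries of a semi-Markov kernel are cumulative functions (nondecreasing
   and right-continuous), so that each has a Lebesgue-Stieltjes measure.  That
   Q i j vanishes on the negative reals and that the rows of [trans_mx Q] sum
   to 1 is forced by [markov_renewal] below for every state i that is visited
   with positive probability. *)
Section kernel.
Context {R : realType} {m : nat}.
Variable Q : 'I_m -> 'I_m -> cumulative R R.

Definition trans_mx : 'M[R]_m :=
  \matrix_(i, j) lim (Q i j t @[t --> +oo%R]).

Definition mean_sojourn_to (i j : 'I_m) : \bar R :=
  (\int[lebesgue_stieltjes_measure (Q i j)]_(t in `[0%R, +oo[) t%:E)%E.

Definition mean_sojourn : 'cV[R]_m :=
  \col_i \sum_k fine (mean_sojourn_to i k).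

End kernel.

Section process.
Context {R : realType} {m : nat} {d : measure_display} {Omega : measurableType d}.
Variables (X : nat -> Omega -> 'I_m) (T : nat -> Omega -> R).

(* The sigma-algebra generated by X_0, T_0, ..., X_n, T_n. *)
Definition past (n : nat) : set (set Omega) :=
  <<s [set A | exists2 k, (k <= n)%N &
         (exists j : 'I_m, A = X k @^-1` [set j]) \/
         (exists2 B : set R, measurable B & A = T k @^-1` B)] >>.

(* The Markov property is the elementary form of
   P(X_{n+1} = j, T_{n+1} - T_n <= t | past n) = Q (X_n) j t  a.s. *)
Record markov_renewal (Q : 'I_m -> 'I_m -> cumulative R R)
    (Pr : probability Omega R) : Prop := MarkovRenewal {
  mrp_state_measurable : forall n j, measurable (X n @^-1` [set j]) ;
  mrp_time_measurable : forall n, measurable_fun setT (T n) ;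
  mrp_time0 : forall w, T 0%N w = 0 ;
  mrp_time_le : forall n w, T n w <= T n.+1 w ;
  mrp_markov : forall (n : nat) (A : set Omega) (i j : 'I_m) (t : R),
    past n A ->
    Pr (A `&` [set w | [/\ X n w = i, X n.+1 w = j &
                           T n.+1 w - T n w <= t]])
    = (Pr (A `&` [set w | X n w = i]) * (Q i j t)%:E)%E }.

(* T_n for the least n >= 1 with X_n = j; +oo when j is never reached. *)
Definition first_passage_time (j : 'I_m) (w : Omega) : \bar R :=
  if pselect (exists r, (0 < r)%N && (X r w == j)) is left h
  then (T (ex_minn h) w)%:E else +oo%E.

(* [Pr i] is the law of the process given X_0 = i. *)
Variable Pr : 'I_m -> probability Omega R.

Definition mean_first_passage (i j : 'I_m) : \bar R :=
  (\int[Pr i]_w first_passage_time j w)%E.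

Definition mixture3 (i : 'I_m) : R :=
  \sum_j fine (mean_first_passage i j) / fine (mean_first_passage j j).

End process.

(* Main.v *)
(** Write tau_j for the first n >= 1 with X_n = j and B_j for P with column j
    replaced by 0.  The event {tau_j > n} belongs to the past up to step n, so
    that P_i(tau_j > n, X_n = k) = (B_j^n)_ik and, T_(tau_j) being the sum of
    the sojourns T_(n+1) - T_n over n < tau_j, m_ij = sum_n (B_j^n mu)_i.
    Irreducibility makes I - B_j invertible by the maximum principle.  Hence
    the partial sums (I - B_j)^-1 (v - B_j^n v) are bounded for v >= 0, the
    series converges, and M = (m_ij) satisfies the first-step equation
    m_ij = mu_i + sum_(k != j) p_ik m_kj.

    Multiplying this equation by pi gives pi_j m_jj = lambda.  Thus
    N = (m_ij / m_jj) satisfies (I - P) N = mu pi^T / lambda - P, and k = N e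
    satisfies (I - P) k = mu / lambda - e; as the kernel of I - P is spanned by
    e, k is constant iff mu = lambda e.  In that case (I - P) N = Pi - P gives
    N = I - Z + e r for a row vector r, and the unit diagonal of N forces
    r e = tr Z, whence k = (tr Z) e. *)

Require Import Defs.
From HB Require Import structures.
From mathcomp Require Import all_boot all_order all_algebra.
From mathcomp Require Import all_classical all_reals all_analysis measurable_realfun.

Import Order.TTheory GRing.Theory Num.Theory.
Import numFieldNormedType.Exports.

Local Open Scope classical_set_scope.
Local Open Scope ring_scope.

(** * Lebesgue-Stieltjes measures as laws of random variables *)

Lemma ge0_integral_mrestr d (T : measurableType d) (R : realType)
    (mu : {measure set T -> \bar R}) (C : set T) (mC : measurable C)
    (f : T -> \bar R) :
  measurable_fun setT f -> (forall x, 0 <= f x)%E ->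
  (\int[mrestr mu mC]_x f x = \int[mu]_(x in C) f x)%E.
Proof.
move=> mf f0.
rewrite (@ge0_negligible_integral _ _ _ _ setT (~` C))//; first last.
- by rewrite /= /mrestr setICl measure0.
- exact: measurableC.
rewrite setDE setCK setTI; apply: eq_measure_integral => A mA AC.
by rewrite /= /mrestr setIidl.
Qed.

Lemma lebesgue_stieltjes_itvoc (R : realType) (F : cumulative R R) (a b : R) :
  a <= b -> lebesgue_stieltjes_measure F `]a, b]%classic = (F b - F a)%:E.
Proof.
move=> ab; rewrite /lebesgue_stieltjes_measure /measure_extension/=.
rewrite measurable_mu_extE//=.
  by rewrite wlength_itv_bnd.
exact: is_ocitv.
Qed.

(** The image under [Y] of [mu] restricted to [C] and the measure of [F] scaled by [c] agree on the
    intervals ]a, b], a generating pi-system, hence on all Borel sets; a change of variables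
    concludes. *)
Lemma integral_stieltjes_law d (Omega : measurableType d) (R : realType)
    (mu : probability Omega R) (C : set Omega) (Y : Omega -> R) (c : R)
    (F : cumulative R R) :
  measurable C -> measurable_fun setT Y -> (forall w, 0 <= Y w) -> 0 <= c ->
  (forall t, mu (C `&` [set w | Y w <= t]) = (c%:E * (F t)%:E)%E) ->
  (\int[mu]_(w in C) (Y w)%:E =
   c%:E * \int[lebesgue_stieltjes_measure F]_(t in `[0%R, +oo[) t%:E)%E.
Proof.
move=> mC mY Y0 c0 muC.
pose cn := NngNum c0.
have -> : c = cn%:num by [].
rewrite -ge0_integral_mscale//; last first.
  by move=> x /=; rewrite in_itv/= andbT lee_fin.
transitivity (\int[pushforward (mrestr mu mC)
    (Y : Omega -> measurableTypeR R)]_(t in `[0%R, +oo[) t%:E)%E; last first.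
  apply: eq_measure_integral => A mA _.
  have cumD (a b : R) : a <= b ->
      mu (C `&` [set w | a < Y w <= b]) = (c%:E * (F b - F a)%:E)%E.
    move=> ab; have mle t : measurable (C `&` [set w | Y w <= t]).
      apply: measurableI => //; rewrite -[X in measurable X]setTI.
      have -> : [set w | Y w <= t] = Y @^-1` `]-oo, t]%classic.
        by apply/seteqP; split => w /=; rewrite in_itv.
      exact: mY.
    have -> : C `&` [set w | a < Y w <= b] =
        (C `&` [set w | Y w <= b]) `\` (C `&` [set w | Y w <= a]).
      apply/seteqP; split => [w [Cw /= /andP[aY Yb]]|w [[Cw /= Yb] nYa]].
        by split=> // -[_] /=; rewrite leNgt aY.
      by split => //=; rewrite Yb andbT ltNge; apply/negP => Ya; exact: nYa.
    rewrite measureD//; last by rewrite ltey_eq fin_num_measure.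
    rewrite setIACA setIid (_ : [set w | Y w <= b] `&` _ = [set w | Y w <= a]).
      transitivity (c%:E * (F b)%:E - c%:E * (F a)%:E)%E.
        by congr (_ - _)%E; exact: muC.
      by rewrite -!EFinM -EFinB mulrBr.
    apply/seteqP; split => w /=; first by case.
    by move=> Ya; split => //; exact: le_trans ab.
  refine (@measure_unique _ R (measurableTypeR R) (@ocitv R)
    (fun n => `]-(n%:R), n%:R]%classic) _ _ _ _ _ _ _ _ _ _) => //.
  - exact: ocitvI.
  - by move=> n; exact: is_ocitv.
  - apply/seteqP; split => // x _; exists (Num.truncn `|x|).+1 => //=.
    rewrite in_itv/=; have := truncnS_gt `|x|; set n := (Num.truncn _).+1 => xn.
    by have /ltr_normlP[] := xn; rewrite ltrNl => -> /ltW ->.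
  - move=> _ [[a b] _ <-] /=; rewrite /mrestr /pushforward /mscale/= setIC.
    have [ab|ba] := leP a b.
      by rewrite lebesgue_stieltjes_itvoc// -cumD.
    rewrite set_itv_ge ?preimage_set0 ?setI0 ?measure0 ?mule0//.
    by rewrite bnd_simp -leNgt ltW.
  - move=> n; rewrite /mrestr /pushforward /=.
    have mYn : measurable (Y @^-1` `]-(n%:R), n%:R]%classic).
      by rewrite -[X in measurable X]setTI; exact: mY.
    rewrite (le_lt_trans (probability_le1 mu _)) ?ltry//.
    exact: measurableI.
rewrite ge0_integral_pushforward//; last first.
  by move=> x /=; rewrite inE/= in_itv/= andbT lee_fin.
have -> : Y @^-1` `[0, +oo[ = setT.
  by apply/seteqP; split => w //= _; rewrite in_itv/= Y0.
rewrite ge0_integral_mrestr//; exact/measurable_EFinP.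
Qed.

(** * Irreducible stochastic matrices *)

(** [det0P] yields a row vector in the left kernel, hence the passage to the transpose. *)
Lemma unitmx_ker0 (F : fieldType) (m : nat) (A : 'M[F]_m) :
  (forall x : 'cV_m, A *m x = 0 -> x = 0) -> A \in unitmx.
Proof.
move=> kerA; rewrite -unitmx_tr unitmxE unitfE; apply/det0P => -[v v0 vA].
case/negP: v0; rewrite -[v]trmxK -trmx0 (inj_eq trmx_inj); apply/eqP/kerA.
by rewrite -[A]trmxK -trmx_mul vA trmx0.
Qed.

Lemma expmxS (R : realType) (m : nat) (A : 'M[R]_m) (n : nat) :
  A ^+ n.+1 = A *m A ^+ n.
Proof. by rewrite exprS mulmxE. Qed.

Lemma expmx_ge0 (R : realType) (m : nat) (A : 'M[R]_m) (n : nat) :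
  (forall i j, 0 <= A i j) -> forall i j, 0 <= (A ^+ n) i j.
Proof.
move=> A0; elim: n => [|n IH] i j; first by rewrite expr0 mxE ler0n.
by rewrite expmxS mxE sumr_ge0// => k _; rewrite mulr_ge0.
Qed.

Section stochastic.
Context {R : realType} {m : nat}.
Variable P : 'M[R]_m.
Hypotheses (P0 : forall i j, 0 <= P i j) (P1 : P *m ones = ones).

Lemma stochastic_row_sum i : \sum_j P i j = 1.
Proof.
have /matrixP/(_ i 0) := P1; rewrite !mxE => <-.
by apply: eq_bigr => j _; rewrite mxE mulr1.
Qed.

Lemma expmx_ones n : P ^+ n *m ones = ones.
Proof.
elim: n => [|n IH]; first by rewrite expr0 mul1mx.
by rewrite expmxS -mulmxA IH.
Qed.

Hypothesis Pirr : irreducible_mx P.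

(** Maximum principle: at a state where [y] is maximal, [y] is at most its average against a row of
    any power of [P], so it is also maximal wherever that row is positive; irreducibility reaches
    every state. *)
Lemma subharmonic_const (y : 'cV[R]_m) :
  (forall i, y i 0 <= (P *m y) i 0) -> forall i j, y i 0 = y j 0.
Proof.
move=> yP.
have yPn n i : y i 0 <= (P ^+ n *m y) i 0.
  elim: n i => [|n IH] i; first by rewrite expr0 mul1mx.
  rewrite expmxS -mulmxA (le_trans (yP i))// !mxE ler_sum// => k _.
  by rewrite ler_wpM2l.
suff ymax i0 : (forall k, y k 0 <= y i0 0) -> forall j, y j 0 = y i0 0.
  move=> i j; pose i0 := [arg max_(k > i) y k 0]%O.
  suff i0max : forall k, y k 0 <= y i0 0 by rewrite !(ymax i0).
  by rewrite /i0; case: arg_maxP => // k _ yk l; exact: yk.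
move=> i0max j; have [n nP] := Pirr i0 j.
have Pn0 := expmx_ge0 _ _ _ n P0.
have t0 k : true -> 0 <= (P ^+ n) i0 k * (y i0 0 - y k 0).
  by move=> _; rewrite mulr_ge0 ?subr_ge0.
have : \sum_k (P ^+ n) i0 k * (y i0 0 - y k 0) = 0.
  apply/le_anti; rewrite sumr_ge0// andbT.
  under eq_bigr do rewrite mulrBr.
  rewrite sumrB -mulr_suml; have := yPn n i0; rewrite mxE.
  have /matrixP/(_ i0 0) := expmx_ones n; rewrite !mxE.
  under eq_bigr do rewrite mxE mulr1.
  by move=> ->; rewrite mul1r subr_le0.
move=> /(psumr_eq0P t0)/(_ j erefl)/eqP; rewrite mulf_eq0 gt_eqF//=.
by rewrite subr_eq0 => /eqP.
Qed.

Lemma harmonic_const (x : 'cV[R]_m) :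
  (1%:M - P) *m x = 0 -> exists c, x = c *: ones.
Proof.
move=> /eqP; rewrite mulmxBl mul1mx subr_eq0 => /eqP xP.
have xc := @subharmonic_const x.
(* The average of [x] names the constant without choosing a state, so an empty state space needs no
   separate case. *)
exists (\sum_i x i 0 / m%:R); apply/matrixP => i j; rewrite !mxE ord1 mulr1.
have m0 : m%:R != 0 :> R.
  by rewrite pnatr_eq0 -lt0n (leq_ltn_trans _ (ltn_ord i)).
rewrite (eq_bigr (fun=> x i 0 / m%:R)); last first.
  by move=> k _; rewrite (xc _ k i)// => l; rewrite -xP.
by rewrite big_const_ord iter_addr addr0 -[_ / _ *+ _]mulr_natr divfK.
Qed.

(** * Taboo matrices: the chain killed on entering a state *)

Definition taboo_mx (j : 'I_m) : 'M[R]_m :=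
  \matrix_(i, k) if k == j then 0 else P i k.

Lemma taboo_mx_ge0 j i k : 0 <= taboo_mx j i k.
Proof. by rewrite mxE; case: eqP. Qed.

Lemma taboo_mx_le j i k : taboo_mx j i k <= P i k.
Proof. by rewrite mxE; case: eqP. Qed.

Lemma taboo_mxE j (v : 'cV[R]_m) i :
  (taboo_mx j *m v) i 0 = \sum_(k | k != j) P i k * v k 0.
Proof.
rewrite mxE [RHS]big_mkcond/=; apply: eq_bigr => k _; rewrite mxE.
by case: eqP; rewrite //= mul0r.
Qed.

(** Irreducibility at [(j, j)] may be witnessed by the power 0, so the argument starts from a
    successor [k] of [j]: a path from [k] to [j] has a last step into [j], or it is empty and
    [P j j] is positive. *)
Lemma irreducible_col_neq0 j : exists i, P i j != 0.
Proof.
apply: contrapT => /forallNP Pj0.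
have {}Pj0 i : P i j = 0 by apply/eqP; have /negP := Pj0 i; rewrite negbK.
have [k Pjk] : exists k, 0 < P j k.
  apply: contrapT => /forallNP Pj; have := stochastic_row_sum j.
  rewrite big1 => [/eqP|k _]; first by rewrite eq_sym oner_eq0.
  by apply/le_anti; rewrite P0 andbT leNgt; apply/negP/Pj.
have [[|n]] := Pirr k j.
  rewrite expr0 mxE; case: eqP => [kj|_]; last by rewrite ltxx.
  by move: Pjk; rewrite kj Pj0 ltxx.
rewrite exprSr -mulmxE mxE big1 ?ltxx// => l _.
by rewrite Pj0 mulr0.
Qed.

(** If [x] is fixed by the taboo matrix, its entrywise absolute value [y] is subharmonic for [P],
    hence constant; a row [i] with positive [P i j] gives y <= (1 - P i j) y, so [y] vanishes. *)
Lemma taboo_unitmx j : 1%:M - taboo_mx j \in unitmx.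
Proof.
apply: unitmx_ker0 => x /eqP; rewrite mulmxBl mul1mx subr_eq0 => /eqP xB.
pose y : 'cV[R]_m := \col_i `|x i 0|.
have yB i : y i 0 <= (taboo_mx j *m y) i 0.
  rewrite !mxE {1}xB mxE (le_trans (ler_norm_sum _ _ _))// ler_sum// => k _.
  by rewrite normrM ger0_norm ?taboo_mx_ge0// !mxE.
have yc : forall i k, y i 0 = y k 0.
  apply: subharmonic_const => i; apply: le_trans (yB i) _.
  by rewrite !mxE ler_sum// => k _; rewrite ler_wpM2r ?taboo_mx_le// mxE.
have [i Pij] := irreducible_col_neq0 j.
have yi0 : y i 0 = 0.
  have := yB i; rewrite taboo_mxE.
  under eq_bigr => k _ do rewrite (yc k i).
  rewrite -mulr_suml; have := stochastic_row_sum i; rewrite (bigD1 j)//=.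
  move=> /(canRL (addKr _)) ->; rewrite mulrDl mul1r lerDr mulNr oppr_ge0.
  rewrite pmulr_rle0 ?lt_neqAle ?P0 1?eq_sym ?Pij// => y0.
  by apply/le_anti; rewrite y0 mxE /=.
by apply/matrixP => k l; rewrite ord1 [RHS]mxE; apply/normr0_eq0;
  have := yc k i; rewrite yi0 mxE.
Qed.

Lemma taboo_expmx_bound j (v : 'cV[R]_m) (c : R) :
  (forall i, 0 <= v i 0 <= c) ->
  forall n i, 0 <= (taboo_mx j ^+ n *m v) i 0 <= c.
Proof.
move=> vc; elim=> [|n IH] i; first by rewrite expr0 mul1mx.
rewrite expmxS -mulmxA mxE sumr_ge0/= => [|k _]; last first.
  by rewrite mulr_ge0 ?taboo_mx_ge0//; have /andP[] := IH k.
rewrite -[leRHS]mul1r -(stochastic_row_sum i) mulr_suml ler_sum// => k _.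
have /andP[? ?] := IH k.
by rewrite ler_pM ?taboo_mx_ge0 ?taboo_mx_le.
Qed.

Lemma taboo_partial_sum j (v : 'cV[R]_m) n :
  \sum_(k < n) taboo_mx j ^+ k *m v =
  invmx (1%:M - taboo_mx j) *m (v - taboo_mx j ^+ n *m v).
Proof.
apply: (canRL (mulKmx (taboo_unitmx j))).
elim: n => [|n IH]; first by rewrite big_ord0 mulmx0 expr0 mul1mx subrr.
rewrite big_ord_recr/= mulmxDr IH mulmxBl mul1mx mulmxA -expmxS.
by rewrite addrA subrK.
Qed.

(** These are the terms of a convergent series: its partial sums are monotone, and bounded through
    the closed form of the geometric sum. *)
Lemma taboo_expmx_cvg0 j (v : 'cV[R]_m) : (forall i, 0 <= v i 0) ->
  forall i, (taboo_mx j ^+ n *m v) i 0 @[n --> \oo] --> 0.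
Proof.
move=> v0 i; set B := taboo_mx j; set W := invmx (1%:M - B).
pose c := \sum_k v k 0.
have vc k : 0 <= v k 0 <= c by rewrite v0 /c (bigD1 k)//= lerDl sumr_ge0.
have Bn := taboo_expmx_bound j v c vc.
apply: (@cvg_series_cvg_0 _ R^o); apply: nondecreasing_is_cvgn.
  apply/nondecreasing_seqP => n; rewrite /series/= big_nat_recr//= lerDl.
  by have /andP[] := Bn n i.
(* Each entry of [v - B ^+ n *m v] lies between [-c] and [c]. *)
exists (\sum_k `|W i k| * c) => _ [n _ <-]; rewrite /series/= big_mkord.
have -> : \sum_(k < n) (B ^+ k *m v) i 0 = (\sum_(k < n) B ^+ k *m v) i 0.
  by rewrite summxE.
rewrite taboo_partial_sum mxE ler_sum// => k _.
rewrite (le_trans (ler_norm _))// normrM ler_wpM2l// !mxE.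
have /andP[Bn0 Bnc] := Bn n k; have /andP[vk0 vkc] := vc k.
rewrite ler_norml; move: Bn0 Bnc; rewrite mxE => Bn0 Bnc.
by rewrite lerBlDr (le_trans vkc) ?lerDl// lerBrDr (le_trans _ vk0)//
  addrC subr_le0.
Qed.

Lemma taboo_series_cvg j (v : 'cV[R]_m) : (forall i, 0 <= v i 0) ->
  forall i, \sum_(k < n) (taboo_mx j ^+ k *m v) i 0 @[n --> \oo] -->
            (invmx (1%:M - taboo_mx j) *m v) i 0.
Proof.
move=> v0 i; set B := taboo_mx j; set W := invmx (1%:M - B).
have SE n : \sum_(k < n) (B ^+ k *m v) i 0 =
    (W *m v) i 0 - \sum_l W i l * (B ^+ n *m v) l 0.
  transitivity ((\sum_(k < n) B ^+ k *m v) i 0); first by rewrite summxE.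
  rewrite taboo_partial_sum mulmxBr [LHS]mxE; congr (_ + _).
  by rewrite [LHS]mxE; congr (- _); exact: mxE.
under eq_fun do rewrite SE.
set a := (W *m v) i 0.
suff : a - \sum_l W i l * (B ^+ n *m v) l 0 @[n --> \oo] -->
    a - \sum_l W i l * 0.
  by under [\sum_l W i l * 0]eq_bigr do rewrite mulr0; rewrite big1_eq subr0.
apply: cvgB; first exact: cvg_cst.
apply: cvg_big => [|l _]; first exact: add_continuous.
by apply: cvgM; [exact: cvg_cst|exact: taboo_expmx_cvg0].
Qed.

End stochastic.

(** * Generalized inverses of the Laplacian *)

Section potential.
Context {R : realType} {m : nat}.
Variables (P : 'M[R]_m) (p : 'cV[R]_m).
Hypotheses (P0 : forall i j, 0 <= P i j) (P1 : P *m ones = ones).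
Hypotheses (Pirr : irreducible_mx P) (pst : stationary_prob P p).
Local Notation A := (1%:M - P).
Local Notation Pi := (ones *m p^T).

Lemma laplacian_ones : A *m ones = 0.
Proof. by rewrite mulmxBl mul1mx P1 subrr. Qed.

Lemma stationary_laplacian : p^T *m A = 0.
Proof. by rewrite mulmxBr mulmx1 pst.1 subrr. Qed.

(** For [x] in the kernel, multiplying by [p^T] kills the Laplacian and leaves [u^T *m x = 0]; so
    [x] is harmonic, hence constant, hence 0. The case [c = 1], [u = p] is the matrix inverted by Z,
    and [c = lambda] serves [mu *m u^T]. *)
Lemma perturbed_laplacian_unitmx (c : R) (u : 'cV[R]_m) :
  c != 0 -> (u^T *m ones) 0 0 != 0 -> A + (c *: ones) *m u^T \in unitmx.
Proof.
move=> c0 u0; apply: unitmx_ker0 => x; rewrite mulmxDl -mulmxA => Ax.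
have ux : u^T *m x = 0.
  have := congr1 (mulmx p^T) Ax.
  rewrite mulmxDr !mulmxA stationary_laplacian mul0mx add0r -scalemxAr pst.2.
  rewrite scalemx1 -mulmxA mul_scalar_mx mulmx0 => /eqP.
  by rewrite scaler_eq0 (negPf c0) => /eqP.
move: Ax; rewrite ux mulmx0 addr0 => /(harmonic_const P P0 P1 Pirr)[a xa].
move: ux; rewrite xa -scalemxAr => /matrixP/(_ 0 0); rewrite mxE [RHS]mxE.
by move/eqP; rewrite mulf_eq0 (negPf u0) orbF => /eqP ->; rewrite scale0r.
Qed.

Lemma fundamental_unitmx : A + Pi \in unitmx.
Proof.
have := @perturbed_laplacian_unitmx 1 p (oner_neq0 _); rewrite scale1r; apply.
by rewrite pst.2 mxE oner_neq0.
Qed.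

Local Notation Z := (invmx (A + Pi)).

Lemma laplacian_addPi_ones : (A + Pi) *m ones = ones.
Proof. by rewrite mulmxDl laplacian_ones add0r -mulmxA pst.2 mulmx1. Qed.

Lemma fundamental_ones : Z *m ones = ones.
Proof.
by apply: (canLR (mulKmx fundamental_unitmx)); rewrite laplacian_addPi_ones.
Qed.

Lemma stationary_fundamental : p^T *m Z = p^T.
Proof.
apply: (canLR (mulmxK fundamental_unitmx)).
by rewrite mulmxDr stationary_laplacian add0r mulmxA pst.2 mul1mx.
Qed.

Lemma mul_laplacian_fundamental : A *m Z = 1%:M - Pi.
Proof.
rewrite -[A in A *m _](addrK Pi) mulmxBl mulmxV ?fundamental_unitmx//.
by rewrite -mulmxA stationary_fundamental.
Qed.

Lemma mul_fundamental_laplacian : Z *m A = 1%:M - Pi.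
Proof.
rewrite -[A in _ *m A](addrK Pi) mulmxBr mulVmx ?fundamental_unitmx//.
by rewrite mulmxA fundamental_ones.
Qed.

Lemma mxtrace_Pi : \tr Pi = 1.
Proof. by rewrite mxtrace_mulC pst.2 mxtrace1. Qed.

Lemma mxtrace_ginverse (G : 'M[R]_m) :
  is_ginverse A G -> \tr Z = 1 + \tr G - \tr (G *m Pi).
Proof.
move=> AGA; rewrite -[RHS]addrA.
have -> : \tr G - \tr (G *m Pi) = \tr (G *m (1%:M - Pi)).
  by rewrite mulmxBr mulmx1 raddfB.
(* This form of the idempotent lets cyclicity of the trace move the last factor in front of [G],
   where [A *m G *m A] appears. *)
have PiE : 1%:M - Pi = A *m Z *m (Z *m A).
  rewrite mul_laplacian_fundamental mul_fundamental_laplacian mulmxBl mul1mx.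
  rewrite mulmxBr mulmx1 mulmxA -[Pi *m ones]mulmxA pst.2 mulmx1 subrr.
  by rewrite subr0.
rewrite {}PiE !mulmxA mxtrace_mulC !mulmxA AGA mul_laplacian_fundamental.
rewrite mulmxBl mul1mx -mulmxA stationary_fundamental raddfB/= mxtrace_Pi.
by rewrite addrC subrK.
Qed.

Lemma group_inverse_exists : is_group_inverse A (Z - Pi).
Proof.
have API : A *m (Z - Pi) = 1%:M - Pi.
  rewrite mulmxBr mul_laplacian_fundamental mulmxA laplacian_ones mul0mx.
  by rewrite subr0.
have PiA : (Z - Pi) *m A = 1%:M - Pi.
  rewrite mulmxBl mul_fundamental_laplacian -mulmxA stationary_laplacian mulmx0.
  by rewrite subr0.
split; last by rewrite API PiA.
  by rewrite API mulmxBl mul1mx -mulmxA stationary_laplacian mulmx0 subr0.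
rewrite PiA mulmxBl mul1mx mulmxBr mulmxA -[Pi *m ones]mulmxA pst.2 mulmx1.
by rewrite -[Pi *m Z]mulmxA stationary_fundamental subrr subr0.
Qed.

Lemma mxtrace_group_inverse (G : 'M[R]_m) :
  is_group_inverse A G -> \tr Z = 1 + \tr G.
Proof.
move=> [AGA GAG AG]; rewrite (mxtrace_ginverse G)// mulmxA.
(* Commutation turns G = G A G into G = G G A, and A annihilates [ones]. *)
have -> : G *m ones = 0.
  by rewrite -GAG -[G *m A *m G]mulmxA AG -!mulmxA laplacian_ones !mulmx0.
by rewrite mul0mx mxtrace0 subr0.
Qed.

(** [ones] is an eigenvector of the perturbed matrix, for the eigenvalue [c * (u^T *m ones) 0 0],
    hence also of its inverse. This makes the inverse a g-inverse of the Laplacian and evaluates its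
    trace against Pi. *)
Lemma mxtrace_rank1_perturbed (c : R) (u : 'cV[R]_m) :
  c != 0 -> (u^T *m ones) 0 0 != 0 ->
  \tr Z = 1 + \tr (invmx (A + (c *: ones) *m u^T))
          - 1 / (c * (u^T *m ones) 0 0).
Proof.
move=> c0 u0; set s := (u^T *m ones) 0 0; set H := _ + _ *m u^T.
have uH : H \in unitmx by exact: perturbed_laplacian_unitmx.
have cs0 : c * s != 0 by rewrite mulf_neq0.
have uones : u^T *m ones = s%:M by exact: mx11_scalar.
have Gones : invmx H *m ones = (c * s)^-1 *: ones.
  apply: (canLR (mulKmx uH)); rewrite -scalemxAr mulmxDl laplacian_ones add0r.
  rewrite -mulmxA uones mul_mx_scalar !scalerA -mulrA [s * c]mulrC mulVf//.
  by rewrite scale1r.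
rewrite (mxtrace_ginverse (invmx H)); last first.
  rewrite /is_ginverse -[X in _ *m X = _](addrK ((c *: ones) *m u^T)) -/H.
  rewrite mulmxBr mulmxKV// -mulmxA -scalemxAl -scalemxAr mulmxA Gones.
  by rewrite -scalemxAl -!scalemxAr mulmxA laplacian_ones mul0mx !scaler0 subr0.
rewrite mulmxA Gones -scalemxAl mxtraceZ mxtrace_Pi mulr1 div1r.
by [].
Qed.

End potential.

(** * Algebraic consequences of the first-step equation *)

Section mean_passage_algebra.
Context {R : realType} {m : nat}.
Variables (P M : 'M[R]_m) (p mu : 'cV[R]_m) (lambda : R).
Hypotheses (P0 : forall i j, 0 <= P i j) (P1 : P *m ones = ones).
Hypotheses (Pirr : irreducible_mx P) (pst : stationary_prob P p).
Hypotheses (lambdaE : lambda = (p^T *m mu) 0 0) (lambda0 : lambda != 0).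
Hypothesis first_step :
  forall i j, M i j = mu i 0 + \sum_(k | k != j) P i k * M k j.

(** When column [j] of the first-step equation is averaged against [p], stationarity makes the terms
    with [k != j] occur on both sides and cancel. *)
Lemma stationary_mean_return j : p j 0 * M j j = lambda.
Proof.
have : \sum_i p i 0 * M i j = lambda + \sum_(k | k != j) p k 0 * M k j.
  under eq_bigr do rewrite first_step mulrDr mulr_sumr.
  rewrite big_split/= exchange_big/= lambdaE mxE; congr (_ + _).
    by apply: eq_bigr => i _; rewrite mxE.
  apply: eq_bigr => k _; have /matrixP/(_ 0 k) := pst.1; rewrite !mxE => <-.
  rewrite mulr_suml; apply: eq_bigr => i _; by rewrite mxE mulrA.
by rewrite (bigD1 j)//= => /addIr.
Qed.

Lemma mean_return_neq0 j : M j j != 0.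
Proof.
by apply: contra_neq lambda0 => Mjj;
  rewrite -(stationary_mean_return j) Mjj mulr0.
Qed.

Let N : 'M[R]_m := \matrix_(i, j) (M i j / M j j).

(** Dividing column [j] by [M j j] makes the diagonal of [N] equal to 1, so completing the sum by
    its missing term [k = j] costs exactly [P i j]; and 1 / M_jj = p_j / lambda. *)
Lemma first_step_normalized : (1%:M - P) *m N = lambda^-1 *: (mu *m p^T) - P.
Proof.
apply/matrixP => i j; rewrite mulmxBl mul1mx !mxE big_ord1 !mxE.
rewrite (bigD1 j)//= mxE divff ?mean_return_neq0// mulr1 opprD addrCA.
rewrite [RHS]addrC.
congr (_ + _); rewrite {1}first_step mulrDl -addrA mulr_suml.
under [X in _ - X]eq_bigr do rewrite mxE mulrA.
rewrite subrr addr0 mulrCA; congr (_ * _).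
apply: (mulIf (mean_return_neq0 j)).
by rewrite mulVf ?mean_return_neq0// -mulrA stationary_mean_return mulVf.
Qed.

Let k := N *m ones.

Lemma laplacian_mixture : (1%:M - P) *m k = lambda^-1 *: mu - ones.
Proof.
rewrite mulmxA first_step_normalized mulmxBl P1 -scalemxAl -mulmxA pst.2.
by rewrite mulmx1.
Qed.

Lemma mixture_const_iff :
  (forall i i', k i 0 = k i' 0) <-> (forall j j', mu j 0 = mu j' 0).
Proof.
split=> [kc j j'|muc].
  suff muE i : mu i 0 = lambda by rewrite !muE.
  have kE : k = k j 0 *: ones.
    apply/matrixP => a b; rewrite ord1 !mxE mulr1.
    by have := kc a j; rewrite mxE => ->; rewrite mxE.
  have := laplacian_mixture.
  rewrite kE -scalemxAr (laplacian_ones P P1) scaler0.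
  move=> /matrixP/(_ i 0); rewrite !mxE => /esym/eqP; rewrite subr_eq0 => /eqP.
  by move/(canRL (mulKf _)); rewrite mulr1 invrK; apply; rewrite invr_eq0.
move=> i i'.
(* A constant [mu] equals its average [lambda] against the probability vector [p]. *)
have muE : mu = lambda *: ones.
  apply/matrixP => a b; rewrite ord1 [RHS]mxE [ones _ _]mxE mulr1 lambdaE mxE.
  under eq_bigr => l _ do rewrite (muc l a).
  rewrite -mulr_suml; have /matrixP/(_ 0 0) := pst.2; rewrite !mxE.
  under eq_bigr do rewrite [ones _ _]mxE mulr1.
  by rewrite mulr1n => ->; rewrite mul1r.
have := laplacian_mixture; rewrite muE scalerA mulVf// scale1r subrr.
by move=> /(harmonic_const P P0 P1 Pirr)[c ->]; rewrite !mxE.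
Qed.

Lemma mixture_eq_trace :
  mu = lambda *: ones ->
  forall i, k i 0 = \tr (invmx (1%:M - P + ones *m p^T)).
Proof.
move=> muE i; set Z := invmx _.
(* With this [r], subtracting [ones *m r] cancels the contribution of Pi N and leaves (I - P) N = Pi
   - P. *)
pose r := p^T *m N.
have uH := fundamental_unitmx P p P0 P1 Pirr pst.
have key : (1%:M - P + ones *m p^T) *m (N - ones *m r) =
    1%:M - P + ones *m p^T - 1%:M.
  rewrite mulmxBr [in LHS]mulmxDl first_step_normalized muE -scalemxAl scalerA.
  rewrite mulVf// scale1r mulmxA (laplacian_addPi_ones P p P1 pst).
  by rewrite -[ones *m p^T *m N]mulmxA addrK [RHS]addrC
    -[X in _ = _ + X]addrA addKr addrC.
have NE : N = 1%:M - Z + ones *m r.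
  apply: (canRL (subrK _)).
  by rewrite -[LHS](mulKmx uH) key mulmxBr mulmx1 mulVmx.
(* The diagonal entries of [N] are 1, so [N] has the trace of the identity. *)
have trZ : (r *m ones) 0 0 = \tr Z.
  have : \tr N = \tr (1%:M : 'M[R]_m).
    by apply: eq_bigr => j _; rewrite !mxE eqxx divff ?mean_return_neq0.
  rewrite NE mxtraceD mxtrace_mulC raddfB/= trace_mx11 => /eqP.
  by rewrite -addrA -subr_eq0 addrAC subrr add0r addrC subr_eq0 => /eqP.
rewrite /k NE mulmxDl mulmxBl mul1mx (fundamental_ones P p P0 P1 Pirr pst).
rewrite subrr add0r -mulmxA [r *m ones]mx11_scalar trZ mul_mx_scalar !mxE.
by rewrite mulr1.
Qed.

End mean_passage_algebra.

(** * Markov renewal processes *)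

Lemma ge0_integral_partition d (T : measurableType d) (R : realType)
    (mu : {measure set T -> \bar R}) (I : finType) (f : T -> I) (D : set T)
    (g : T -> \bar R) :
  measurable D -> (forall i, measurable (f @^-1` [set i])) ->
  measurable_fun setT g -> (forall x, 0 <= g x)%E ->
  (\int[mu]_(x in D) g x =
   \sum_(i : I) \int[mu]_(x in D `&` f @^-1` [set i]) g x)%E.
Proof.
move=> mD mf mg g0.
under eq_bigr do rewrite integral_mkcondr.
rewrite -ge0_integral_sum//.
- apply: eq_integral => x _; rewrite (bigD1 (f x))//= patchE mem_set//.
  rewrite big1 ?adde0// => i /eqP ifx; rewrite patchE memNset//= => fxi.
  exact: ifx.
- by move=> i; apply/measurable_restrict => //; exact: measurable_funTS.
- by move=> i x _; exact: erestrict_ge0.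
Qed.

Lemma measure_partition d (T : measurableType d) (R : realType)
    (mu : {measure set T -> \bar R}) (I : finType) (f : T -> I) (D : set T) :
  measurable D -> (forall i, measurable (f @^-1` [set i])) ->
  (mu D = \sum_(i : I) mu (D `&` f @^-1` [set i]))%E.
Proof.
move=> mD mf; rewrite -[LHS]mul1e -integral_cst//.
rewrite (@ge0_integral_partition _ _ _ _ _ f)//.
by apply: eq_bigr => i _; rewrite integral_cst ?mul1e//; exact: measurableI.
Qed.

(** * Avoidance events and sojourn times under a single law *)

Section markov_renewal_facts.
Context {R : realType} {m : nat} {d : measure_display}
  {Omega : measurableType d}.
Variables (X : nat -> Omega -> 'I_m) (T : nat -> Omega -> R).
Variables (Q : 'I_m -> 'I_m -> cumulative R R) (mu : probability Omega R).
Hypothesis MRP : markov_renewal X T Q mu.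

Lemma past_measurable n A : past X T n A -> measurable A.
Proof.
move: A; apply: smallest_sub; first exact: sigma_algebra_measurable.
move=> _ [k _ [[j ->]|[B mB ->]]]; first exact: mrp_state_measurable MRP _ _.
by rewrite -[X in measurable X]setTI; exact: mrp_time_measurable MRP _ _ _ mB.
Qed.

Lemma sojourn_ge0 n w : 0 <= T n.+1 w - T n w.
Proof. by rewrite subr_ge0 (mrp_time_le MRP). Qed.

Lemma sojourn_measurable n : measurable_fun setT (fun w => T n.+1 w - T n w).
Proof. by apply: measurable_funB; exact: (mrp_time_measurable MRP). Qed.

Lemma sojourn_le_measurable n t :
  measurable [set w | T n.+1 w - T n w <= t].
Proof.
rewrite [X in measurable X](_ : _ = setT `&`
    (fun w => T n.+1 w - T n w) @^-1` `]-oo, t]%classic).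
  exact: sojourn_measurable.
by apply/seteqP; split => w /=; rewrite in_itv/=; tauto.
Qed.

(** The event tau_j > n. Time 0 is left out, so that a process started in [j] waits for its
    return. *)
Definition avoid (j : 'I_m) (n : nat) : set Omega :=
  [set w | forall r, (0 < r <= n)%N -> X r w != j].

Lemma past_avoid n N j : (n <= N)%N -> past X T N (avoid j n).
Proof.
move=> nN; pose F r := if (0 < r <= n)%N then X r @^-1` [set j] else set0.
have -> : avoid j n = setT `\` \bigcup_r F r.
  apply/seteqP; split => [w wE|w [_ /= wF] r rn]; last first.
    by apply/eqP => Xr; apply: wF; exists r => //; rewrite /F rn.
  split=> // -[r _]; rewrite /F; case: ifP => // rn /= Xr.
  by have := wE r rn; rewrite Xr eqxx.
have [S0 SC SU] := smallest_sigma_algebra setT [set A | exists2 k, (k <= N)%N &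
         (exists j : 'I_m, A = X k @^-1` [set j]) \/
         (exists2 B : set R, measurable B & A = T k @^-1` B)].
apply: SC; apply: SU => r; rewrite /F; case: ifP => // /andP[_ rn].
apply: sub_sigma_algebra; exists r; first exact: leq_trans nN.
by left; exists j.
Qed.

Lemma past_setT n : past X T n setT.
Proof.
have [S0 SC _] := smallest_sigma_algebra setT [set A | exists2 k, (k <= n)%N &
         (exists j : 'I_m, A = X k @^-1` [set j]) \/
         (exists2 B : set R, measurable B & A = T k @^-1` B)].
by rewrite -(setD0 setT); exact: SC.
Qed.

Lemma measurable_avoid j n : measurable (avoid j n).
Proof. exact: past_measurable (past_avoid n n j (leqnn n)). Qed.

Lemma measurable_step A n i j : past X T n A ->
  measurable (A `&` [set w | X n w = i /\ X n.+1 w = j]).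
Proof.
move=> /past_measurable mA; apply: measurableI => //.
by apply: measurableI; exact: mrp_state_measurable MRP _ _.
Qed.

Lemma markov_step_le n A i j t : past X T n A ->
  mu ((A `&` [set w | X n w = i /\ X n.+1 w = j]) `&`
      [set w | T n.+1 w - T n w <= t]) =
  (mu (A `&` [set w | X n w = i]) * (Q i j t)%:E)%E.
Proof.
move=> pA; rewrite -(mrp_markov MRP)//; congr (mu _).
by apply/seteqP; split=> w /=; [case=> -[? [? ?] ?]|case=> ? [? ? ?]].
Qed.

(** Continuity from below: sojourn times are real, so the bounds [k] exhaust the event. *)
Lemma cvg_step n A i j : past X T n A ->
  mu ((A `&` [set w | X n w = i /\ X n.+1 w = j]) `&`
      [set w | T n.+1 w - T n w <= k%:R]) @[k --> \oo] -->
  mu (A `&` [set w | X n w = i /\ X n.+1 w = j]).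
Proof.
move=> pA; set C := A `&` _; have mC : measurable C by exact: measurable_step.
set F := fun k : nat => C `&` [set w | T n.+1 w - T n w <= k%:R].
have mF k : measurable (F k).
  by apply: measurableI => //; exact: sojourn_le_measurable.
have CE : C = \bigcup_k F k.
  rewrite /F -setI_bigcupr [X in _ `&` X](_ : _ = setT) ?setIT//.
  apply/seteqP; split => // w _.
  exists (Num.truncn (T n.+1 w - T n w)).+1 => //=.
  exact/ltW/truncnS_gt.
suff : mu (F k) @[k --> \oo] --> mu (\bigcup_k F k) by rewrite -CE.
apply: (@nondecreasing_cvg_mu _ _ _ mu F) => //.
  exact: bigcupT_measurable.
move=> a b ab; apply/subsetPset => w [Cw /= wa]; split => //=.
by rewrite (le_trans wa)// ler_nat.
Qed.

(** By the Markov property, the sojourn time on this event has the distribution function [Q i j]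
    scaled by the probability of [A] with X_n = i. *)
Lemma integral_sojourn_step n A i j : past X T n A ->
  (\int[mu]_(w in A `&` [set w | X n w = i /\ X n.+1 w = j])
     (T n.+1 w - T n w)%:E =
   mu (A `&` [set w | X n w = i]) * mean_sojourn_to Q i j)%E.
Proof.
move=> pA; set c := mu (A `&` _).
have mc : measurable (A `&` [set w | X n w = i]).
  apply: measurableI; first exact: past_measurable pA.
  exact: mrp_state_measurable MRP _ _.
have cE : c = (fine c)%:E by rewrite fineK// fin_num_measure.
rewrite {1}cE (@integral_stieltjes_law _ _ _ _ _ _ (fine c) (Q i j))//.
- exact: measurable_step.
- exact: sojourn_measurable.
- exact: sojourn_ge0.
- by rewrite fine_ge0// measure_ge0.
- by move=> t; rewrite -cE markov_step_le.
Qed.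

End markov_renewal_facts.

(** * The kernel, passage probabilities and mean passage times *)

Section kernel_facts.
Context {R : realType} {m : nat} {d : measure_display}
  {Omega : measurableType d}.
Variables (X : nat -> Omega -> 'I_m) (T : nat -> Omega -> R).
Variables (Q : 'I_m -> 'I_m -> cumulative R R).
Variable Pr : 'I_m -> probability Omega R.
Hypothesis MRP : forall i, markov_renewal X T Q (Pr i).
Hypothesis X0 : forall i, Pr i [set w | X 0%N w = i] = 1%E.
Local Notation P := (trans_mx Q).

(** The Markov property at step 0, under the law started in [i]. The bounds on [Q] rest on this
    identification. *)
Lemma kernel_prob i j t : (Q i j t)%:E =
  Pr i ([set w | X 0%N w = i /\ X 1%N w = j] `&`
        [set w | T 1%N w - T 0%N w <= t]).
Proof.
have := markov_step_le X T Q (Pr i) (MRP i) 0%N setT i j t.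
by rewrite !setTI X0 mul1e => ->//; exact: past_setT.
Qed.

Lemma measurable_step_le (x : 'I_m) t k l n : measurable
  ([set w | X n w = k /\ X n.+1 w = l] `&` [set w | T n.+1 w - T n w <= t]).
Proof.
apply: measurableI; last exact: sojourn_le_measurable (MRP x) _ _.
have := measurable_step X T Q _ (MRP x) setT n k l; rewrite setTI; apply.
exact: past_setT.
Qed.

Lemma kernel_ge0 i j t : 0 <= Q i j t.
Proof. by rewrite -lee_fin kernel_prob measure_ge0. Qed.

Lemma kernel_le1 i j t : Q i j t <= 1.
Proof.
rewrite -lee_fin kernel_prob probability_le1//.
exact: (measurable_step_le i).
Qed.

(** [lim] takes a default value where no limit exists; monotonicity and the bound 1 show that
    [trans_mx] consists of true limits. *)
Lemma kernel_cvg i j : Q i j t @[t --> +oo] --> P i j.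
Proof.
have Qcvg : Q i j t @[t --> +oo] --> sup (range (Q i j)).
  apply: nondecreasing_cvgr; first exact: cumulative_is_nondecreasing.
  by exists 1 => _ [t _ <-]; exact: kernel_le1.
by rewrite mxE; exact: cvgP Qcvg.
Qed.

Lemma trans_mx_ge0 i j : 0 <= P i j.
Proof.
apply: (cvgr_to_ge (kernel_cvg i j)).
by apply: nearW => t; exact: kernel_ge0.
Qed.

(** The bound on the sojourn time tends to infinity on both sides of the Markov property. *)
Lemma markov_step n x A i j : past X T n A ->
  Pr x (A `&` [set w | X n w = i /\ X n.+1 w = j]) =
  (Pr x (A `&` [set w | X n w = i]) * (P i j)%:E)%E.
Proof.
move=> pA.
apply: (cvg_unique _ (cvg_step X T Q (Pr x) (MRP x) n A i j pA)) => //.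
rewrite /=; under eq_fun do rewrite (markov_step_le X T Q (Pr x) (MRP x))//.
have mA : measurable (A `&` [set w | X n w = i]).
  apply: measurableI; first exact: past_measurable (MRP x) _ _ pA.
  exact: mrp_state_measurable (MRP x) _ _.
apply: cvgeZl; first by rewrite fin_num_measure.
apply: cvg_EFin; first exact: nearW.
have /cvg_pinftyP := kernel_cvg i j; apply; exact: cvgr_idn.
Qed.

Lemma trans_mx_ones : P *m ones = ones.
Proof.
apply/matrixP => i k; rewrite [LHS]mxE [RHS]mxE; apply: EFin_inj.
have mS n j : measurable (X n @^-1` [set j]).
  exact: mrp_state_measurable (MRP i) _ _.
transitivity (Pr i [set w | X 0%N w = i]); last exact: X0.
rewrite (measure_partition _ _ _ _ _ (X 1%N))//; last exact: mS.
rewrite -sumEFin; apply: eq_bigr => j _; rewrite [ones _ _]mxE mulr1.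
have := markov_step 0%N i setT i j (past_setT _ _ _).
by rewrite !setTI X0 mul1e => <-.
Qed.

(** Induction on [n]: splitting on X_n and one Markov step multiply by [P], while an arrival in [j]
    at step n+1 is excluded, which is the erased column. *)
Lemma avoid_prob j x n k :
  Pr x (avoid X j n `&` [set w | X n w = k]) = ((taboo_mx P j ^+ n) x k)%:E.
Proof.
have mS l i : measurable (X l @^-1` [set i]).
  exact: mrp_state_measurable (MRP x) _ _.
elim: n k => [|n IH] k.
  rewrite expr0 mxE (_ : avoid X j 0 = setT); last first.
    by apply/seteqP; split => // w _ [].
  rewrite setTI; have [<-|xk] := eqVneq x k; first exact: X0.
  have nX0 : Pr x (~` [set w | X 0%N w = x]) = 0%E.
    by rewrite probability_setC ?X0 ?subee//; exact: mS.
  apply: (@subset_measure0 _ _ _ (Pr x) _ (~` [set w | X 0%N w = x])).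
  - exact: mS.
  - exact/measurableC/mS.
  - by move=> w /= -> kx; rewrite kx eqxx in xk.
  - exact: nX0.
have EE : avoid X j n.+1 `&` [set w | X n.+1 w = k] =
    if k == j then set0 else avoid X j n `&` [set w | X n.+1 w = k].
  case: eqP => [->|/eqP kj].
    by apply/seteqP; split => // w [/(_ n.+1 (leqnn _))] /eqP Xj /Xj.
  apply/seteqP; split => w [wE Xk]; split => // r /andP[r0 rn].
    by apply: wE; rewrite r0 leqW.
  move: rn; rewrite leq_eqVlt => /predU1P[->|rn]; first by rewrite Xk.
  by apply: wE; rewrite r0.
rewrite EE exprSr -mulmxE mxE.
under eq_bigr => l _ do rewrite [taboo_mx _ _ l k]mxE.
case: eqP => _; first by rewrite measure0 big1// => l _; rewrite mulr0.
rewrite (measure_partition _ _ _ _ _ (X n)); first last.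
- exact: mS.
- apply: measurableI; last exact: mS.
  exact: (measurable_avoid X T Q _ (MRP x)).
rewrite -sumEFin; apply: eq_bigr => l _; rewrite EFinM -IH -markov_step.
  by rewrite -setIA; congr (Pr x (_ `&` _)); apply/seteqP; split => w [].
exact: past_avoid.
Qed.
Hypothesis Pirr : irreducible_mx P.
Hypothesis Qfin : forall i j, (mean_sojourn_to Q i j < +oo)%E.

Lemma mean_sojourn_to_ge0 i j : (0 <= mean_sojourn_to Q i j)%E.
Proof. by apply: integral_ge0 => t /=; rewrite in_itv/= andbT lee_fin. Qed.

Lemma mean_sojourn_ge0 i : 0 <= mean_sojourn Q i 0.
Proof.
by rewrite mxE sumr_ge0// => j _; rewrite fine_ge0// mean_sojourn_to_ge0.
Qed.

Lemma mean_sojournE i :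
  (\sum_j mean_sojourn_to Q i j = (mean_sojourn Q i 0)%:E)%E.
Proof.
rewrite [mean_sojourn _ _ _]mxE -sumEFin; apply: eq_bigr => j _.
by rewrite fineK// ge0_fin_numE ?mean_sojourn_to_ge0.
Qed.

(** After splitting on X_n and X_(n+1), the sum over the next state gives [mean_sojourn], and the
    sum over the current one gives the matrix product. *)
Lemma integral_sojourn_avoid x j n :
  (\int[Pr x]_(w in avoid X j n) (T n.+1 w - T n w)%:E =
   ((taboo_mx P j ^+ n *m mean_sojourn Q) x 0)%:E)%E.
Proof.
have mS l i : measurable (X l @^-1` [set i]).
  exact: mrp_state_measurable (MRP x) _ _.
have mD : measurable_fun setT (fun w => (T n.+1 w - T n w)%:E).
  exact/measurable_EFinP/(sojourn_measurable X T Q _ (MRP x)).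
have D0 w : (0 <= (T n.+1 w - T n w)%:E)%E.
  by rewrite lee_fin; exact: (sojourn_ge0 X T Q _ (MRP x)).
have mE := measurable_avoid X T Q _ (MRP x) j n.
rewrite (ge0_integral_partition _ _ _ _ _ (X n))// [in RHS]mxE -sumEFin.
apply: eq_bigr => k _.
rewrite (ge0_integral_partition _ _ _ _ _ (X n.+1))//; last exact: measurableI.
rewrite EFinM -avoid_prob -mean_sojournE ge0_sume_distrr; last first.
  by move=> l _; exact: mean_sojourn_to_ge0.
apply: eq_bigr => l _.
rewrite -(integral_sojourn_step X T Q _ (MRP x)); last exact: past_avoid.
by rewrite -setIA.
Qed.

(** The probability of avoiding [j] for [n] steps is an entry of B_j^n e, which tends to 0, and it
    bounds that of avoiding [j] forever. *)
Lemma never_prob0 x j : Pr x (\bigcap_n avoid X j n) = 0%E.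
Proof.
have mE := measurable_avoid X T Q _ (MRP x) j.
have mN : measurable (\bigcap_n avoid X j n) by exact: bigcapT_measurable.
apply/le_anti; rewrite measure_ge0 andbT.
have cvg0 : Pr x (avoid X j n) @[n --> \oo] --> 0%E.
  have PE n : Pr x (avoid X j n) = ((taboo_mx P j ^+ n *m ones) x 0)%:E.
    rewrite (measure_partition _ _ _ _ _ (X n))//; last first.
      by move=> i; exact: mrp_state_measurable (MRP x) _ _.
    rewrite mxE -sumEFin; apply: eq_bigr => k _.
    by rewrite [ones _ _]mxE mulr1 -avoid_prob.
  under eq_fun do rewrite PE.
  apply: cvg_EFin; first exact: nearW.
  apply: (taboo_expmx_cvg0 P trans_mx_ge0 trans_mx_ones Pirr).
  by move=> i; rewrite mxE.
apply: (cvge_to_ge cvg0); apply: nearW => n.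
by apply: le_measure; rewrite ?inE//; exact: bigcap_inf.
Qed.

Definition sojourn_before (j : 'I_m) (n : nat) : Omega -> \bar R :=
  (fun w => (T n.+1 w - T n w)%:E) \_ (avoid X j n).

(* If j is never reached, the series is lim_n T_n, which may be finite: the
   second term restores the value +oo. *)
Lemma first_passage_time_series j w :
  (first_passage_time X T j w =
   \sum_(n <oo) sojourn_before j n w +
   ((cst +oo) \_ (\bigcap_n avoid X j n)) w)%E.
Proof.
have g0 n : (0 <= sojourn_before j n w)%E.
  by apply: erestrict_ge0 => v _; rewrite lee_fin (sojourn_ge0 X T Q _ (MRP j)).
rewrite /first_passage_time; case: pselect => [h|nh].
  case: ex_minnP => r /andP[r0 /eqP Xr] rmin.
  (* With [r] the first passage, exactly the sojourns of index n < r count; the last one ends at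
     T_r, and the sum telescopes to T_r - T_0. *)
  have avoidE n : (w \in avoid X j n) = (n < r)%N.
    apply/idP/idP; rewrite inE.
      move=> wE; rewrite ltnNge; apply/negP => rn.
      by have := wE r; rewrite r0 rn Xr eqxx => /(_ erefl).
    move=> nr k /andP[k0 kn]; apply/negP => Xk.
    have := rmin k; rewrite k0 Xk => /(_ erefl).
    by rewrite leqNgt (leq_ltn_trans kn nr).
  rewrite [X in (_ + X)%E]patchE memNset/=; last first.
    by move=> /(_ r I)/mem_set; rewrite avoidE ltnn.
  rewrite adde0 (@nneseries_split _ _ 0 r) => [|k _]; last exact: g0.
  rewrite eseries0 ?adde0 => [|k]; last first.
    by rewrite add0n => rk _; rewrite /sojourn_before patchE avoidE ltnNge rk.
  rewrite add0n big_nat (eq_bigr (fun k => (T k.+1 w - T k w)%:E)); last first.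
    by move=> k /andP[_ kr]; rewrite /sojourn_before patchE avoidE kr.
  by rewrite -big_nat sumEFin telescope_sumr// (mrp_time0 (MRP j)) subr0.
rewrite [X in (_ + X)%E]patchE mem_set/=.
  have S0 : (0 <= \sum_(n <oo) sojourn_before j n w)%E.
    by apply: nneseries_ge0 => n _ _; exact: g0.
  by rewrite addey// gt_eqF// (lt_le_trans ltNy0).
move=> n _ r /andP[r0 _]; apply/negP => Xr; apply: nh.
by exists r; rewrite r0 Xr.
Qed.

(** Monotone convergence integrates the series term by term; the terms are entries of B_j^n mu, and
    the infinite part lives on a null set. *)
Lemma mean_first_passageE i j :
  mean_first_passage X T Pr i j =
  ((invmx (1%:M - taboo_mx P j) *m mean_sojourn Q) i 0)%:E.
Proof.
have mE := measurable_avoid X T Q _ (MRP i) j.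
have mN : measurable (\bigcap_n avoid X j n) by exact: bigcapT_measurable.
have mD n : measurable_fun setT (fun w => (T n.+1 w - T n w)%:E).
  exact/measurable_EFinP/(sojourn_measurable X T Q _ (MRP i)).
have D0 n w : (0 <= (T n.+1 w - T n w)%:E)%E.
  by rewrite lee_fin; exact: (sojourn_ge0 X T Q _ (MRP i)).
have mg n : measurable_fun setT (sojourn_before j n).
  by apply/measurable_restrict => //; exact: measurable_funTS.
have g0 n w : (0 <= sojourn_before j n w)%E by exact: erestrict_ge0.
rewrite /mean_first_passage.
under eq_integral do rewrite first_passage_time_series.
rewrite ge0_integralD//; last 4 first.
- by move=> w _; exact: nneseries_ge0.
- exact: ge0_emeasurable_sum.
- by move=> w _; apply: erestrict_ge0 => v _; exact: leey.
- by apply/measurable_restrict => //; exact: measurable_cst.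
have -> : (\int[Pr i]_w ((cst +oo) \_ (\bigcap_n avoid X j n)) w = 0)%E.
  by rewrite -integral_mkcond null_set_integral//; exact: never_prob0.
rewrite adde0.
rewrite integral_nneseries//.
apply/cvg_lim => //.
rewrite (_ : (fun n => _) = fun n =>
    (\sum_(k < n) (taboo_mx P j ^+ k *m mean_sojourn Q) i 0)%:E).
  apply: cvg_EFin; first exact: nearW.
  exact: (taboo_series_cvg P trans_mx_ge0 trans_mx_ones Pirr _ _
    mean_sojourn_ge0).
apply/funext => n; rewrite big_mkord -sumEFin; apply: eq_bigr => k _.
by rewrite -integral_mkcond integral_sojourn_avoid.
Qed.

(** For the column v of mean passage times into [j], the equation is (I - B_j) v = mu, so it comes
    from the closed form, without conditioning on the first jump. *)
Lemma mean_first_passage_first_step i j :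
  fine (mean_first_passage X T Pr i j) = mean_sojourn Q i 0 +
  \sum_(k | k != j) P i k * fine (mean_first_passage X T Pr k j).
Proof.
under eq_bigr do rewrite mean_first_passageE/=.
rewrite mean_first_passageE /= -taboo_mxE.
set v := invmx _ *m _.
have -> : mean_sojourn Q = (1%:M - taboo_mx P j) *m v.
  rewrite /v mulKVmx//.
  exact: (taboo_unitmx P trans_mx_ge0 trans_mx_ones Pirr).
by rewrite mulmxBl mul1mx [X in X + _]mxE [X in _ + X + _]mxE subrK.
Qed.

End kernel_facts.

Theorem corollary3p1 (R : realType) (m : nat)
    (d : measure_display) (Omega : measurableType d)
    (X : nat -> Omega -> 'I_m) (T : nat -> Omega -> R)
    (Q : 'I_m -> 'I_m -> cumulative R R)
    (Pr : 'I_m -> probability Omega R)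
    (P : 'M[R]_m) (pi mu : 'cV[R]_m) (lambda : R) (k3 : 'I_m -> R)
    (hMRP : forall i, markov_renewal X T Q (Pr i))
    (hX0 : forall i, Pr i [set w | X 0%N w = i] = 1%E)
    (hP : P = trans_mx Q)
    (hirr : irreducible_mx P)
    (hfin : forall i j, (mean_sojourn_to Q i j < +oo)%E)
    (hmu : mu = mean_sojourn Q)
    (hpi : stationary_prob P pi)
    (hlambda : lambda = (pi^T *m mu) 0 0)
    (hlambda0 : 0 < lambda)
    (hk3 : k3 = mixture3 X T Pr) :
  (* the ratios defining k3 are meaningful *)
  (forall i j, mean_first_passage X T Pr i j \is a fin_num) /\
  (forall j, mean_first_passage X T Pr j j != 0%E) /\
  (* k3 is independent of the initial state iff mu is constant *)
  ((forall i i', k3 i = k3 i') <-> (forall j j', mu j 0 = mu j' 0)) /\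
  (mu = lambda *: ones ->
   exists KC : R,
     [/\ forall i, k3 i = KC,
         forall G, is_ginverse (1%:M - P) G ->
           KC = 1 + \tr G - \tr (G *m (ones *m pi^T)),
         1%:M - P + ones *m pi^T \in unitmx /\
           KC = \tr (invmx (1%:M - P + ones *m pi^T)),
         (exists As, is_group_inverse (1%:M - P) As) /\
           (forall As, is_group_inverse (1%:M - P) As -> KC = 1 + \tr As)
       & forall u : 'cV[R]_m, (u^T *m ones) 0 0 != 0 ->
           1%:M - P + mu *m u^T \in unitmx /\
           KC = 1 + \tr (invmx (1%:M - P + mu *m u^T))
                - 1 / (lambda * (u^T *m ones) 0 0)]).
Proof.
have P0 : forall i j, 0 <= P i j by rewrite hP; exact: trans_mx_ge0 hMRP hX0.
have P1 : P *m ones = ones by rewrite hP; exact: trans_mx_ones hMRP hX0.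
have hirrQ : irreducible_mx (trans_mx Q) by rewrite -hP.
have MfinE := mean_first_passageE X T Q Pr hMRP hX0 hirrQ hfin.
pose M : 'M[R]_m := \matrix_(i, j) fine (mean_first_passage X T Pr i j).
have step : forall i j,
    M i j = mu i 0 + \sum_(k | k != j) P i k * M k j.
  move=> i j; rewrite mxE hmu hP.
  rewrite (mean_first_passage_first_step X T Q Pr hMRP hX0 hirrQ hfin).
  by congr (_ + _); apply: eq_bigr => k _; rewrite [M k j]mxE.
have l0 : lambda != 0 by rewrite gt_eqF.
have Mjj := mean_return_neq0 P M pi mu lambda hpi hlambda l0 step.
pose N : 'M[R]_m := \matrix_(i, j) (M i j / M j j).
have kE i : k3 i = (N *m ones) i 0.
  rewrite hk3 /mixture3 [RHS]mxE; apply: eq_bigr => j _.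
  by rewrite [ones _ _]mxE mulr1 !mxE.
split; first by move=> i j; rewrite MfinE.
split.
  by move=> j; apply: contra_neq (Mjj j) => Mj0; rewrite mxE Mj0.
split.
  have := mixture_const_iff P M pi mu lambda P0 P1 hirr hpi hlambda l0 step.
  move=> [kmu muk]; split=> [kc|/muk kc i i']; last by rewrite !kE.
  by apply: kmu => i i'; rewrite -!kE.
(* The constant is taken to be tr Z, with which all the other traces have been compared. *)
move=> muE; exists (\tr (invmx (1%:M - P + ones *m pi^T))); split.
- move=> i; rewrite kE.
  exact: (mixture_eq_trace P M pi mu lambda P0 P1 hirr hpi hlambda l0 step muE).
- by move=> G /(mxtrace_ginverse P pi P0 P1 hirr hpi).
- by split; first exact: fundamental_unitmx.
- split; first by eexists; exact: (group_inverse_exists P pi P0 P1 hirr hpi).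
  by move=> G /(mxtrace_group_inverse P pi P0 P1 hirr hpi).
(* Here [mu *m u^T] is the rank-one perturbation with [c = lambda]. *)
- move=> u u0; rewrite muE; split.
    exact: (perturbed_laplacian_unitmx P pi P0 P1 hirr hpi).
  exact: (mxtrace_rank1_perturbed P pi P0 P1 hirr hpi).
Qed.
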